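(* Let $d_1,d_2\ge 3$ be integers with $d_1>d_2+4$. Then there exists $\varepsilon=\varepsilon(d_1)>0$ such that, with probability tending to $1$ as $n\to\infty$, the graph $G\sim\mathcal{G}(n,d_1,d_2)$ with true partition $(\mathcal{A},\mathcal{B})$ has the following property: for any partition $(A,B)$ of $[2n]$ with $|A\cap\mathcal{A}|>(1-\varepsilon)n$ and $|B\cap\mathcal{B}|>(1-\varepsilon)n$, if one sets $(A_0,B_0)=(A,B)$ and lets $(A_i,B_i)$ be the output of the Majority step applied to $(A_{i-1},B_{i-1})$, then $(A_t,B_t)=(\mathcal{A},\mathcal{B})$ after $t=O(\log n)$ iterations, where the constant in $O(\cdot)$ depends on $\varepsilon$ and $d_1$.
   Context: The regular stochastic block model $\mathcal{G}(n,d_1,d_2)$ is the random graph on vertex set $[2n]$ obtained as follows: choose an equipartition $(\mathcal{A},\mathcal{B})$ of $[2n]$ uniformly at random; independently choose uniformly random simple $d_1$-regular graphs on $\mathcal{A}$ and on $\mathcal{B}$; independently, connect $\mathcal{A}$ and $\mathcal{B}$ by a uniformly random simple $d_2$-regular bipartite graph. The graph is the union of these three graphs. Only $n$ with $nd_1$ even are considered. Majority step: given a partition $(A,B)$ of the vertex set (not necessarily an equipartition), let $\sigma_i=+1$ if $i\in A$ and $\sigma_i=-1$ if $i\in B$; for every vertex $i$ simultaneously set $\hat\sigma_i=\mathrm{sign}\big(\sum_{j\sim i}\sigma_j\big)$ (sum over neighbours $j$ of $i$ in $G$, with some fixed convention assigning $\mathrm{sign}(0)\in\{+1,-1\}$);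 output $A_1=\{i:\hat\sigma_i=+1\}$, $B_1=\{i:\hat\sigma_i=-1\}$. *)

(* Defs.v *)
From HB Require Import structures.
From mathcomp Require Import all_boot all_order all_algebra.
Set Implicit Arguments. Unset Strict Implicit. Unset Printing Implicit Defensive.
Import Order.TTheory GRing.Theory Num.Theory.

(* Vertex set [2n] is modelled by 'I_(n.*2).  A (simple) graph is a set of
   ordered pairs, symmetric and irreflexive; an edge {x,y} appears as both
   (x,y) and (y,x). *)
Notation vtx n := ('I_(n.*2)).
Notation graph n := {set (vtx n * vtx n)}.

Definition simple_graph n (G : graph n) : bool :=
  [forall x, forall y, ((x, y) \in G) == ((y, x) \in G)] &&
  [forall x, (x, x) \notin G].

Definition nbrs n (G : graph n) (x : vtx n) : {set vtx n} :=
  [set y | (x, y) \in G].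

Definition regular_on n (S : {set vtx n}) (d : nat) (G : graph n) : bool :=
  simple_graph G && (G \subset setX S S) &&
  [forall x in S, #|nbrs G x| == d].

Definition bip_regular_on n (S T : {set vtx n}) (d : nat) (H : graph n) : bool :=
  simple_graph H && (H \subset setX S T :|: setX T S) &&
  [forall x in S :|: T, #|nbrs H x| == d].

Definition sbm_triples n (d1 d2 : nat) (A : {set vtx n})
  : {set (graph n * graph n * graph n)} :=
  [set t | regular_on A d1 t.1.1 && regular_on (~: A) d1 t.1.2
           && bip_regular_on A (~: A) d2 t.2].

Definition sbm_graph n (t : graph n * graph n * graph n) : graph n :=
  t.1.1 :|: t.1.2 :|: t.2.

(* Probability, under the regular SBM G(n,d1,d2), of the event E(A_true, G):
   the equipartition (A_true, ~: A_true) is uniform among ordered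
   equipartitions; given it, the triple (G_A, G_B, H) is uniform among the
   admissible triples, and G is their union. *)
Definition sbm_prob n (d1 d2 : nat) (E : {set vtx n} -> graph n -> bool) : rat :=
  (#|[set A : {set vtx n} | #|A| == n]|%:R)^-1 *
  \sum_(A : {set vtx n} | #|A| == n)
     ((#|[set t in sbm_triples d1 d2 A | E A (sbm_graph t)]|%:R : rat)
       / #|sbm_triples d1 d2 A|%:R).

Definition spin n (A : {set vtx n}) (j : vtx n) : int :=
  if j \in A then 1%R else (-1)%R.

(* One Majority step; [tie] is the fixed convention sign(0) = +1 iff tie. *)
Definition majority_step n (tie : bool) (G : graph n) (A : {set vtx n})
  : {set vtx n} :=
  [set i | let s := (\sum_(j in nbrs G i) spin A j)%R in
           (0 < s)%R || ((s == 0%R) && tie)].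

(* Main.v *)
Require Import Defs.
From HB Require Import structures.
From mathcomp Require Import all_boot all_order all_algebra.
From mathcomp Require Import zify.
Set Implicit Arguments. Unset Strict Implicit. Unset Printing Implicit Defensive.
Import Order.TTheory GRing.Theory Num.Theory.

(* Let W be the set of misclassified vertices on one side. Since d1 - d2 >= 5, a
   vertex that is misclassified after a step has at least 3 neighbours in W on
   its own side. If the set W' of such vertices had more than 5|W|/6 elements,
   then U = W u W' would span at least 5|U|/4 edges of the d1-regular graph on
   that side. In a uniform d-regular graph on s vertices a switching argument
   shows that a given set of k = O(s) edges is present with probability at most
   (2d/s)^k, so a union bound excludes such U of size at most a small multiple
   of s, except with probability O(1/s). Hence |W| shrinks by a factor 5/6 at
   each step as soon as it is a small enough multiple of n. Circulant graphs show
   that the model is nonempty, without which the ratios in [sbm_prob] would be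
   0 / 0 = 0. *)

(** * Double counting, and graphs as symmetric sets of arcs *)

Lemma card_pairs (T U : finType) (E : {set T * U}) :
  #|E| = \sum_x #|[set y | (x, y) \in E]|.
Proof.
rewrite -sum1_card (eq_bigl (fun p => true && ((p.1, p.2) \in E))); last by case.
rewrite -(pair_big_dep xpredT (fun x y => (x, y) \in E) (fun _ _ => 1)) /=.
by apply: eq_bigr => x _; rewrite -sum1_card; apply: eq_bigl => y; rewrite inE.
Qed.

Lemma card_pairs_in (T U : finType) (P : {set T}) (E : {set T * U}) :
  #|[set e in E | e.1 \in P]| = \sum_(x in P) #|[set y | (x, y) \in E]|.
Proof.
rewrite card_pairs [RHS]big_mkcond /=; apply: eq_bigr => x _.
case: ifP => xP; first by apply: eq_card => y; rewrite !inE xP andbT.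
by apply: eq_card0 => y; rewrite !inE xP andbF.
Qed.

Lemma card_pairs_le (T U : finType) (P : {set T}) (E : {set T * U}) k :
  (forall x, x \in P -> #|[set y | (x, y) \in E]| <= k) ->
  #|[set e in E | e.1 \in P]| <= #|P| * k.
Proof.
by move=> H; rewrite card_pairs_in -sum_nat_const; apply: leq_sum.
Qed.

Lemma card_flip (T U : finType) (E : {set T * U}) :
  #|[set e : U * T | (e.2, e.1) \in E]| = #|E|.
Proof.
have bij : bijective (fun e : U * T => (e.2, e.1)).
  by exists (fun e : T * U => (e.2, e.1)) => -[].
by rewrite -(on_card_preimset (onW_bij _ bij)); apply: eq_card => e; rewrite !inE.
Qed.

Lemma simple_graphP n (G : graph n) :
  reflect ((forall x y, ((x, y) \in G) = ((y, x) \in G)) /\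
           (forall x, (x, x) \notin G))
          (simple_graph G).
Proof.
apply: (iffP andP) => -[sym irr]; split.
- by move=> x y; apply/eqP; move: x y; apply/'forall_forallP.
- exact/forallP.
- by apply/'forall_forallP => x y; rewrite sym.
- exact/forallP.
Qed.

Lemma regular_onP n (S : {set vtx n}) d (G : graph n) :
  reflect [/\ forall x y, ((x, y) \in G) = ((y, x) \in G),
              forall x, (x, x) \notin G,
              forall x y, (x, y) \in G -> x \in S
            & forall x, x \in S -> #|nbrs G x| = d]
          (regular_on S d G).
Proof.
apply: (iffP andP) => [[/andP[/simple_graphP[sym irr] /subsetP sub] reg]|].
  split=> // [x y /sub|x xS]; first by rewrite inE => /andP[].
  by apply/eqP; apply: (forall_inP reg).
case=> sym irr sub reg; split; last by apply/forall_inP => x xS; rewrite reg.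
apply/andP; split; first exact/simple_graphP.
apply/subsetP => -[x y] xyG; rewrite inE /= (sub _ _ xyG).
by move: xyG; rewrite sym => /sub.
Qed.

Lemma in_nbrs n (G : graph n) x y : (y \in nbrs G x) = ((x, y) \in G).
Proof. by rewrite inE. Qed.

(** * Switchings in regular graphs and the probability of containing given edges *)

Section Switching.
Variables (n d : nat) (S : {set vtx n}).
Implicit Types (G F : graph n) (x y a b : vtx n).

(** Both orientations of the 4-cycle [x], [y], [b], [a]. Toggling it removes the edges [xy], [ab]
    and inserts [xa], [yb]; as a symmetric difference, the operation is its own inverse. *)
Definition switch_cycle x y a b : graph n :=
  [set (x, y); (y, x); (a, b); (b, a); (x, a); (a, x); (y, b); (b, y)].

Definition switch G x y a b : graph n :=
  [set e | (e \in G) (+) (e \in switch_cycle x y a b)].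

Lemma switchK G x y a b : switch (switch G x y a b) x y a b = G.
Proof. by apply/setP => e; rewrite !inE addbK. Qed.

(** The arcs [(a, b)] for which [xa] and [yb] are neither loops nor edges of [G], and whose removal
    does not damage [F]. *)
Definition switchable G F x y : graph n :=
  [set e in G | [&& e.1 != x, (x, e.1) \notin G, e.2 != y, (y, e.2) \notin G,
                    e \notin F & (e.2, e.1) \notin F]].

(** At each vertex of the cycle a switch trades one neighbour [p] for one non-neighbour [q], which
    keeps the degree. *)
Lemma card_swap_nbr (T : finType) (N : {set T}) p q :
  p \in N -> q \notin N ->
  #|[set v | (v \in N) (+) ((v == p) || (v == q))]| = #|N|.
Proof.
move=> pN qN.
have -> : [set v | (v \in N) (+) ((v == p) || (v == q))] = q |: (N :\ p).
  apply/setP => v; rewrite !inE.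
  case: (eqVneq v q) => [->|vq]; first by rewrite (negPf qN) orbT.
  by case: (eqVneq v p) => [->|vp]; rewrite ?pN ?addbF.
rewrite cardsU1 !inE (negPf qN) andbF /=.
by rewrite (cardsD1 p N) pN.
Qed.

Lemma switch_regular G F x y a b :
  regular_on S d G -> (x, y) \in G -> (a, b) \in switchable G F x y ->
  regular_on S d (switch G x y a b).
Proof.
move=> /regular_onP[sym irr sub reg] xyG.
rewrite inE /= => /andP[abG /and5P[ax xa bY yb _]].
have xy : x != y by apply: contraNneq (irr x) => {2}->.
have ab : a != b by apply: contraNneq (irr a) => {2}->.
have ay : a != y by apply: contraNneq xa => ->.
have bx : b != x by apply: contraNneq yb => ->; rewrite sym.
have yxG : (y, x) \in G by rewrite sym.
have baG : (b, a) \in G by rewrite sym.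
have ayG : (a, x) \notin G by rewrite sym.
have byG : (b, y) \notin G by rewrite sym.
have xS := sub _ _ xyG; have yS := sub _ _ yxG.
have aS := sub _ _ abG; have bS := sub _ _ baG.
apply/regular_onP; split.
- move=> u v; rewrite !inE sym !xpair_eqE; congr (_ (+) _).
  by rewrite !(andbC (u == _)); do 8?[case: (_ && _)] => //=; rewrite ?orbT.
- move=> u; rewrite !inE (negPf (irr u)) !xpair_eqE /=.
  apply/negP; rewrite -!orbA.
  by repeat (case/orP); case/andP => /eqP-> /eqP E;
    rewrite ?E ?eqxx in xy ab ax bY.
- move=> u v; rewrite inE; case: ((u, v) \in G) (sub u v) => [/(_ isT)//|_] /=.
  rewrite !inE !xpair_eqE -!orbA.
  by repeat (case/orP); case/andP => /eqP-> _.
move=> u uS; rewrite -(reg u uS).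
case: (boolP (u \in [set x; y; a; b])); last first.
  rewrite !inE !negb_or -!andbA => /and4P[ux uy ua ub].
  apply: eq_card => v; rewrite !inE !xpair_eqE.
  by rewrite (negPf ux) (negPf uy) (negPf ua) (negPf ub) /= addbF.
have E p q : nbrs (switch G x y a b) u =
   [set v | (v \in nbrs G u) (+) ((v == p) || (v == q))] -> p \in nbrs G u ->
   q \notin nbrs G u -> #|nbrs (switch G x y a b) u| = #|nbrs G u|.
  by move=> -> pN qN; apply: card_swap_nbr.
rewrite !inE -!orbA => /or4P[] /eqP eu; subst u.
- apply: (E y a); rewrite ?in_nbrs //; apply/setP => v; rewrite !inE !xpair_eqE eqxx.
  rewrite (negPf xy) !(eq_sym x) (negPf ax) (negPf bx) /=.
  by rewrite !orbF.
- apply: (E x b); rewrite ?in_nbrs //; apply/setP => v; rewrite !inE !xpair_eqE eqxx.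
  rewrite !(eq_sym y) (negPf xy) (negPf ay) (negPf bY) /=.
  by rewrite !orbF.
- apply: (E b x); rewrite ?in_nbrs //; apply/setP => v; rewrite !inE !xpair_eqE eqxx.
  rewrite (negPf ab) (negPf ax) (negPf ay) /=.
  by rewrite !orbF.
- apply: (E a y); rewrite ?in_nbrs //; apply/setP => v; rewrite !inE !xpair_eqE eqxx.
  rewrite (eq_sym b a) (negPf ab) (negPf bx) (negPf bY) /=.
  by rewrite !orbF.
Qed.

Lemma card_nbrs_le G v : regular_on S d G -> #|nbrs G v| <= d.
Proof.
case/regular_onP=> sym irr sub reg.
have [/reg-> //|vS] := boolP (v \in S).
rewrite eq_card0 // => w; rewrite in_nbrs; apply/negbTE.
by apply: contra vS => /sub.
Qed.

Lemma card_regular G : regular_on S d G -> #|G| = #|S| * d.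
Proof.
case/regular_onP=> sym irr sub reg.
have -> : #|G| = #|[set e in G | e.1 \in S]|.
  by apply: eq_card => -[x y]; rewrite inE /=; case: (boolP (_ \in G)) => // /sub->.
by rewrite card_pairs_in -sum_nat_const; apply: eq_bigr => x /reg.
Qed.

(** An arc of [G] can fail only by starting in the closed neighbourhood of [x], ending in that of
    [y], or lying in [F] up to reversal. Each closed neighbourhood accounts for at most [d * d.+1]
    arcs. *)
Lemma card_switchable G F x y : regular_on S d G -> (x, y) \in G ->
  #|S| * d <= #|switchable G F x y| + 2 * (d * d.+1) + 2 * #|F|.
Proof.
move=> regG xyG; rewrite -(card_regular regG).
have [sym irr sub reg] := regular_onP _ _ _ regG.
have touch v : #|[set e in G | e.1 \in v |: nbrs G v]| <= d * d.+1.
  apply: (@leq_trans (#|v |: nbrs G v| * d)).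
    by apply: card_pairs_le => w _; apply: card_nbrs_le.
  rewrite mulnC leq_mul2l cardsU1 -[X in _ <= X]add1n leq_add ?leq_b1 ?orbT //.
  exact: card_nbrs_le.
pose Gx := [set e in G | e.1 \in x |: nbrs G x].
pose Gy := [set e : vtx n * vtx n | (e.2, e.1) \in [set e in G | e.1 \in y |: nbrs G y]].
pose F' := [set e : vtx n * vtx n | (e.2, e.1) \in F].
have : G \subset switchable G F x y :|: Gx :|: Gy :|: F :|: F'.
  apply/subsetP => -[a b] abG; rewrite !inE /= abG -(sym a b) abG /=.
  by do ![case: eqP => //= _ | case: (boolP (_ \in _)) => //= _].
move/subset_leq_card/leq_trans; apply.
have Gx_le : #|Gx| <= d * d.+1 := touch x.
have Gy_le : #|Gy| <= d * d.+1 by rewrite card_flip.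
have F'_le : #|F'| = #|F| := card_flip F.
have U1 := (leq_card_setU (switchable G F x y) Gx).1.
have U2 := (leq_card_setU (switchable G F x y :|: Gx) Gy).1.
have U3 := (leq_card_setU (switchable G F x y :|: Gx :|: Gy) F).1.
have U4 := (leq_card_setU (switchable G F x y :|: Gx :|: Gy :|: F) F').1.
have := leq_trans U2 (leq_add (leq_trans U1 (leq_add (leqnn _) Gx_le)) Gy_le).
move=> /(fun H => leq_trans U3 (leq_add H (leqnn _))).
move=> /(fun H => leq_trans U4 (leq_add H (eq_leq F'_le)))/leq_trans; apply.
by rewrite -!addnA !leq_add2l; lia.
Qed.

Definition regular_graphs : {set graph n} := [set G | regular_on S d G].
Definition containing F : {set graph n} := [set G in regular_graphs | F \subset G].

(* Double counting of pairs (graph, switching): a graph through [(x, y)] has at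
   least [#|S| * d / 2] forward switchings, and a graph has at most [d ^ 2]
   backward ones, given by a neighbour of [x] and one of [y]. *)
Lemma containing_edge F x y :
  0 < d -> 8 * d.+1 <= #|S| -> 8 * #|F| <= #|S| * d ->
  (x, y) \notin F -> (y, x) \notin F ->
  #|containing ((x, y) |: F)| * #|S| <= 2 * d * #|containing F|.
Proof.
move=> d_gt0 S_large F_small xyF yxF.
pose fwd := [set p : graph n * (vtx n * vtx n) |
  (p.1 \in containing ((x, y) |: F)) && (p.2 \in switchable p.1 F x y)].
pose bwd := [set p : graph n * (vtx n * vtx n) |
  (p.1 \in containing F) && (p.2 \in setX (nbrs p.1 x) (nbrs p.1 y))].
have le_fwd : #|containing ((x, y) |: F)| * (#|S| * d) <= 2 * #|fwd|.
  have -> : fwd = [set e in fwd | e.1 \in containing ((x, y) |: F)].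
    by apply/setP => e; rewrite [RHS]inE; have [|//] := boolP (e \in _); rewrite inE => /andP[->].
  rewrite card_pairs_in -sum_nat_const big_distrr /=.
  apply: leq_sum => G GX; have := GX; rewrite !inE subUset sub1set.
  case/and3P => regG xyG FG.
  have -> : [set q | (G, q) \in fwd] = switchable G F x y.
    by apply/setP => q; rewrite inE [LHS]inE GX.
  (* Each of the two losses in [card_switchable] is at most a quarter of [#|S| * d], so at least
     half of the arcs are switchable. *)
  have deg_small : 2 * (d * d.+1) * 4 <= #|S| * d.
    by have := leq_mul S_large (leqnn d); nia.
  have arith k l p q : k <= l + p + q -> p * 4 <= k -> q * 4 <= k -> k <= 2 * l by lia.
  apply: arith (card_switchable F regG xyG) deg_small _.
  by rewrite mulnAC.
have le_bwd : #|bwd| <= #|containing F| * (d * d).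
  have -> : bwd = [set e in bwd | e.1 \in containing F].
    by apply/setP => e; rewrite [RHS]inE; have [|//] := boolP (e \in _); rewrite inE => /andP[->].
  apply: card_pairs_le => G GY.
  have := GY; rewrite !inE => /andP[regG _].
  apply: leq_trans (_ : #|setX (nbrs G x) (nbrs G y)| <= _).
    by apply/subset_leq_card/subsetP => q; rewrite inE [_ \in bwd]inE GY.
  by rewrite cardsX leq_mul ?card_nbrs_le.
have le_fb : #|fwd| <= #|bwd|.
  (* Keeping [(a, b)] next to the switched graph makes the map injective, since the same switch
     undoes it. *)
  pose f (p : graph n * (vtx n * vtx n)) := (switch p.1 x y p.2.1 p.2.2, p.2).
  have f_inj : injective f.
    move=> [G [a b]] [G' [a' b']] [/= + Ea Eb]; rewrite {}Ea {}Eb.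
    by move=> /(congr1 (fun H => switch H x y a' b')); rewrite !switchK => ->.
  rewrite -(card_imset _ f_inj); apply/subset_leq_card/subsetP => _ /imsetP[[G [a b]] + ->].
  rewrite [_ \in fwd]inE [_ \in containing _]inE [_ \in regular_graphs]inE.
  rewrite subUset sub1set /= => /andP[/and3P[regG xyG FG] sw].
  rewrite [_ \in bwd]inE [_ \in containing _]inE [_ \in regular_graphs]inE.
  rewrite (switch_regular regG xyG sw) in_setX !in_nbrs /=.
  have [sym irr sub reg] := regular_onP _ _ _ regG.
  have := sw; rewrite inE /= => /andP[abG /and5P[ax xa bY yb /andP[abF baF]]].
  have ax' : (a, x) \notin G by rewrite sym.
  have by' : (b, y) \notin G by rewrite sym.
  apply/andP; split; last by rewrite !inE (negPf xa) (negPf yb) !eqxx !orbT.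
  (* [F] survives: the removed arcs lie outside [F], and the inserted ones were outside [G], which
     contains [F]. *)
  apply/subsetP => e eF; rewrite inE (subsetP FG e eF) /=.
  rewrite !inE; apply/negP; rewrite -!orbA.
  have eG := subsetP FG e eF.
  by repeat (case/orP); move/eqP=> E; move: eF eG; rewrite E
    ?(negPf xyF, negPf yxF, negPf abF, negPf baF)
    ?(negPf xa, negPf ax', negPf yb, negPf by').
have: #|containing ((x, y) |: F)| * (#|S| * d) <= 2 * (#|containing F| * (d * d)).
  by apply: leq_trans le_fwd _; rewrite leq_mul2l (leq_trans le_fb).
by rewrite !mulnA leq_pmul2r //; move=> le; nia.
Qed.

(** At most one of the two arcs of each edge is present, so that [#|F|] counts edges. *)
Definition oriented F := forall x y, (x, y) \in F -> (y, x) \notin F.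

(** Adding the edges of [F] one by one, each costs a factor [2 * d / #|S|] by [containing_edge]. *)
Lemma containing_count F :
  0 < d -> 8 * d.+1 <= #|S| -> oriented F -> 8 * #|F| <= #|S| * d ->
  #|containing F| * #|S| ^ #|F| <= (2 * d) ^ #|F| * #|regular_graphs|.
Proof.
move=> d_gt0 S_large; move: {-2}F (erefl #|F|); elim: #|F| => [|k IHk] {}F.
  move=> F0 _ _; rewrite F0 muln1 mul1n.
  by apply/subset_leq_card/subsetP => G; rewrite !inE => /andP[].
move=> Fk oF F_small.
have /card_gt0P[[x y] xyF] : 0 < #|F| by rewrite Fk.
have F'k : #|F :\ (x, y)| = k by move: (cardsD1 (x, y) F); rewrite xyF Fk => -[].
have oF' : oriented (F :\ (x, y)).
  move=> u v; rewrite !inE negb_and => /andP[_ /oF uv].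
  by rewrite (negPf uv) orbT.
have F'_small : 8 * #|F :\ (x, y)| <= #|S| * d.
  by apply: leq_trans F_small; rewrite leq_mul2l F'k Fk leqnSn.
have := IHk _ F'k oF' F'_small; rewrite F'k Fk.
have := @containing_edge (F :\ (x, y)) x y d_gt0 S_large F'_small.
rewrite !inE eqxx (negPf (oF _ _ xyF)) andbF setD1K // => /(_ isT isT) le1 le2.
rewrite !expnS mulnA; apply: leq_trans (leq_mul le1 (leqnn _)) _.
by rewrite -!mulnA !leq_mul2l le2 !orbT.
Qed.
End Switching.

(** * Numerical estimates for the union bound *)

Lemma card_bigcup_le (I T : finType) (P : pred I) (A : I -> {set T}) :
  #|\bigcup_(i | P i) A i| <= \sum_(i | P i) #|A i|.
Proof.
elim/big_rec2: _ => [|i y B _ le]; first by rewrite cards0.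
by apply: leq_trans (leq_card_setU _ _) _; rewrite leq_add2l.
Qed.

Lemma leq_exp2rW m n e : m <= n -> m ^ e <= n ^ e.
Proof. by case: e => // e mn; rewrite leq_exp2r. Qed.

Lemma leq_ffact_exp n m : n ^_ m <= n ^ m.
Proof.
elim: m n => [|m IHm] [|n]; rewrite ?ffactn0 ?ffact0n //.
rewrite ffactSS expnS leq_mul2l (leq_trans (IHm n)) ?orbT //.
by rewrite leq_exp2rW.
Qed.

Lemma leq_exp_ffact n m : n ^ m <= (n + m) ^_ m.
Proof.
elim: m => [|m IHm]; first by rewrite ffactn0.
by rewrite addnS ffactSS expnS leq_mul // (leq_trans (leq_addr m n)).
Qed.

(* [k ^ k / k`!] is at most the central binomial coefficient, hence at most [4 ^ k]. *)
Lemma expnn_le_fact k : k ^ k <= 4 ^ k * k`!.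
Proof.
apply: leq_trans (leq_exp_ffact k k) _; rewrite -bin_ffact leq_mul2r.
apply/orP; right; rewrite (_ : 4 = 2 ^ 2) // -expnM mul2n -addnn.
rewrite (expnDn 1 1) (bigD1 (inord k)) //= inordK ?ltnS ?leq_addr //.
by rewrite !exp1n !muln1 leq_addr.
Qed.

Lemma bin_mul_fact_le n m : 'C(n, m) * m`! <= n ^ m.
Proof. by rewrite bin_ffact leq_ffact_exp. Qed.

(* With [k = u + j] and [u <= 4 * j], Stirling-type bounds turn the union bound
   over vertex sets of size [u] and edge sets of size [k] into a [j]-th power. *)
Lemma union_bound_arith b r s d u j :
  0 < s -> 0 < d -> 0 < u -> u <= 4 * j ->
  b * s ^ (u + j) <= 'C(s, u) * 'C(u * u, u + j) * ((2 * d) ^ (u + j) * r) ->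
  b * s ^ j <= (4 ^ 9 * (2 * d) ^ 5 * u) ^ j * r.
Proof.
move=> s_gt0 d_gt0 u_gt0 uj; set k := u + j => le_b.
have k_le : k <= 5 * j by rewrite /k; lia.
have uk_le : u + k <= 9 * j by lia.
have u_fact := expnn_le_fact u.
have k_fact : u ^ k <= 4 ^ k * k`!.
  by apply: leq_trans (expnn_le_fact k); rewrite leq_exp2rW // leq_addr.
have su := bin_mul_fact_le s u; have uuk := bin_mul_fact_le (u * u) k.
(* Multiplying by [u ^ u * u ^ k] trades the factorials under both binomials for powers of 4. *)
have step : b * s ^ k * (u ^ u * u ^ k) <=
    s ^ u * (u * u) ^ k * ((2 * d) ^ k * r) * (4 ^ u * 4 ^ k).
  apply: leq_trans (leq_mul (leqnn _) (leq_mul u_fact k_fact)) _.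
  apply: leq_trans (leq_mul le_b (leqnn _)) _.
  rewrite [X in X <= _](_ : _ = ('C(s, u) * u`!) * ('C(u * u, k) * k`!) *
     ((2 * d) ^ k * r) * (4 ^ u * 4 ^ k)); last by lia.
  by do 2![apply: leq_mul => //]; apply: leq_mul.
(* Since [u ^ k = u ^ u * u ^ j], cancelling [s ^ u * (u ^ u * u ^ k)] leaves only [u ^ j]; the
   bounds [9 * j] and [5 * j] on the exponents then give the constants 9 and 5. *)
have {step} : b * s ^ j <= 4 ^ (u + k) * (2 * d) ^ k * u ^ j * r.
  have pos : 0 < s ^ u * (u ^ u * u ^ k) by rewrite !muln_gt0 !expn_gt0 s_gt0 u_gt0.
  rewrite -(leq_pmul2r pos); move: step.
  rewrite /k expnD (expnMn u u) -/k {4}/k !expnD; lia.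
move/leq_trans; apply; rewrite leq_mul2r; apply/orP; right.
have : 0 < 2 * d by rewrite muln_gt0.
move: (2 * d) => D D_gt0; rewrite (expnMn _ u) (expnMn _ (D ^ 5)) -(expnM 4) -(expnM D).
rewrite leq_mul2r; apply/orP; right.
by apply: leq_mul; apply: leq_pexp2l.
Qed.

(** One factor [M * u / s] is kept to gain [1 / s]; the other [j - 1] are at most 1/256 each. As
    [256 ^ j = 2 ^ (8 * j)] is at least [4 ^ u], hence at least [u * 2 ^ u], this absorbs [u] and
    leaves a bound summable over [u]. *)
Lemma geometric_decay b r s M u j :
  0 < M -> 0 < u -> u <= 4 * j -> 256 * M * u <= s ->
  b * s ^ j <= (M * u) ^ j * r -> b * s * 2 ^ u <= 256 * M * r.
Proof.
move=> M_gt0 u_gt0; case: j => [|i] uj us le_b; first by lia.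
have pos : 0 < (M * u) ^ i by rewrite expn_gt0 muln_gt0 M_gt0 u_gt0.
have le1 : b * s * 256 ^ i <= M * u * r.
  rewrite -(leq_pmul2r pos) -mulnA -expnMn mulnA.
  apply: leq_trans (_ : b * s * s ^ i <= _); first by rewrite leq_mul2l leq_exp2rW ?orbT.
  by move: le_b; rewrite !expnS; lia.
have le2 : 2 ^ u * u <= 256 ^ i * 256.
  rewrite mulnC -expnSr (_ : 256 = 2 ^ 8) // -expnM.
  apply: leq_trans (leq_mul (ltnW (ltn_expl u (isT : 1 < 2))) (leqnn _)) _.
  by rewrite -expnD leq_pexp2l //; lia.
rewrite -(leq_pmul2r u_gt0) -mulnA.
apply: leq_trans (leq_mul (leqnn _) le2) _; rewrite mulnA.
by apply: leq_trans (leq_mul le1 (leqnn _)) _; lia.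
Qed.

Lemma sum_geometric_le (b : nat -> nat) c m :
  (forall u, u < m -> b u * 2 ^ u.+1 <= c) -> \sum_(u < m) b u <= c.
Proof.
(* The induction needs the sharper bound [c * (1 - 2 ^ (- m))] on the partial sums. *)
move=> le_b; suff : (\sum_(u < m) b u) * 2 ^ m + c <= c * 2 ^ m.
  by move=> le; rewrite -(@leq_pmul2r (2 ^ m)) ?expn_gt0 //; lia.
elim: m le_b => [|m IHm] le_b; first by rewrite big_ord0 mul0n muln1.
have := IHm (fun u um => le_b u (ltnW um)).
by rewrite big_ord_recr /= expnS; have := le_b m (ltnSn m); rewrite expnS; lia.
Qed.

(** * Sparsity of small vertex sets in random regular graphs *)

Definition inner n (G : graph n) (U : {set vtx n}) : graph n := G :&: setX U U.

(* [inner G U] counts every edge twice, so a dense set of size [u] spans at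
   least [5 u / 4] edges. *)
Definition dense n (G : graph n) (U : {set vtx n}) : bool :=
  5 * #|U| <= 2 * #|inner G U|.

(** Every nonempty set of at most [#|S| / L] vertices has average internal degree below 5/2. The
    empty set is [dense], hence the condition [0 < #|U|]. *)
Definition sparse n (L : nat) (S : {set vtx n}) (G : graph n) : bool :=
  [forall U : {set vtx n},
     [&& U \subset S, 0 < #|U| & L * #|U| <= #|S|] ==> ~~ dense G U].

(** One orientation for each pair in [U], so that its subsets are [oriented]. *)
Definition ascending n (U : {set vtx n}) : graph n :=
  [set e in setX U U | e.1 < e.2].

Lemma card_inner_le n (S : {set vtx n}) d (G : graph n) (U : {set vtx n}) :
  regular_on S d G -> #|inner G U| <= 2 * #|G :&: ascending U|.
Proof.
case/regular_onP=> sym irr _ _.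
pose asc' := [set e : vtx n * vtx n | (e.2, e.1) \in G :&: ascending U].
have -> : 2 * #|G :&: ascending U| = #|G :&: ascending U| + #|asc'|.
  by rewrite card_flip mul2n addnn.
apply: leq_trans (leq_card_setU _ _); apply/subset_leq_card/subsetP => -[x y].
rewrite !inE /= -(sym x y) => /and3P[xyG -> ->]; rewrite xyG /=.
by case: ltngtP => // /val_inj xy; rewrite xy (negPf (irr y)) in xyG.
Qed.

(** At least [5 * #|U| / 4] ascending arcs lie in [G]; the size of [F] is this bound rounded up, a
    fixed number that the union bound can range over. *)
Lemma dense_edges n (S : {set vtx n}) d (G : graph n) (U : {set vtx n}) :
  regular_on S d G -> dense G U ->
  exists2 F : graph n, F \subset G :&: ascending U &
    #|F| = #|U| + (#|U| + 3) %/ 4.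
Proof.
move=> regG; rewrite /dense => dU; have le := card_inner_le U regG.
set k := #|U| + _; have /card_gt0P[F] :
    0 < #|[set F : graph n | F \subset G :&: ascending U & #|F| == k]|.
  by rewrite cards_draws bin_gt0 /k; lia.
by rewrite inE => /andP[sub /eqP]; exists F.
Qed.

Section UnionBound.
Variables (n d : nat) (S : {set vtx n}).
Hypotheses (d_gt0 : 0 < d) (S_large : 8 * d.+1 <= #|S|).

(** [M] is the constant of [union_bound_arith]; [L] makes [M * u / #|S|] at most 1/256, as
    [geometric_decay] requires. *)
Let M := 4 ^ 9 * (2 * d) ^ 5.
Let L := 256 * M.

Definition dense_graphs u : {set graph n} :=
  [set G in regular_graphs d S |
    [exists U : {set vtx n}, [&& U \subset S, #|U| == u & dense G U]]].

(** Union bound over the sets [U] of size [u] and the sets [F] of [u + j] ascending arcs in [U],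
    with [containing_count] for each [F]. *)
Lemma card_dense_graphs u : 0 < u -> L * u <= #|S| ->
  #|dense_graphs u| * #|S| * 2 ^ u <= L * #|regular_graphs d S|.
Proof.
move=> u_gt0 u_small; set j := (u + 3) %/ 4; set s := #|S|.
have M_gt0 : 0 < M by rewrite muln_gt0 !expn_gt0 muln_gt0 d_gt0.
have uj : u <= 4 * j by rewrite /j; lia.
apply: (@geometric_decay _ _ _ _ _ j) => //.
apply: union_bound_arith => //; first by apply: leq_trans S_large.
pose Us := [set U : {set vtx n} | U \subset S & #|U| == u].
pose Fs U := [set F : graph n | F \subset ascending U & #|F| == u + j].
have cover : dense_graphs u \subset
    \bigcup_(U in Us) \bigcup_(F in Fs U) containing d S F.
  apply/subsetP => G; rewrite inE => /andP[regG /existsP[U /and3P[US /eqP Uu dU]]].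
  have regG' : regular_on S d G by rewrite inE in regG.
  have [F] := dense_edges regG' dU; rewrite subsetI Uu => /andP[FG FU] /eqP Fk.
  apply/bigcupP; exists U; first by rewrite inE US Uu eqxx.
  by apply/bigcupP; exists F; rewrite inE ?FU ?regG.
have {cover} := subset_leq_card cover.
move/leq_trans => /(_ _ (card_bigcup_le _ _)) le_b.
apply: leq_trans (leq_mul le_b (leqnn _)) _.
rewrite -mulnA -(cards_draws S u) big_distrl /= -sum_nat_const.
apply: leq_sum => U; rewrite inE => /andP[US /eqP Uu].
apply: leq_trans (leq_mul (card_bigcup_le _ _) (leqnn _)) _.
apply: (@leq_trans (#|Fs U| * ((2 * d) ^ (u + j) * #|regular_graphs d S|))).
  rewrite big_distrl /= -sum_nat_const; apply: leq_sum => F.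
  rewrite inE => /andP[FU /eqP Fk].
  have := @containing_count n d S F d_gt0 S_large; rewrite Fk; apply.
  - move=> x y xyF; apply/negP => yxF.
    have := subsetP FU _ xyF; have := subsetP FU _ yxF.
    by rewrite !inE /=; lia.
  (* Here [j <= u], so [8 * (u + j) <= 16 * u <= L * u <= #|S|]. *)
  - apply: leq_trans (leq_mul (leqnn s) d_gt0); rewrite muln1.
    apply: leq_trans u_small; have : 16 <= L by rewrite /L; lia.
    rewrite /j; move/(leq_mul (leqnn u)); lia.
rewrite leq_mul2r cards_draws leq_bin2l ?orbT //.
apply: leq_trans (_ : #|setX U U| <= _); last by rewrite cardsX Uu.
by apply/subset_leq_card/subsetP => e; rewrite !inE => /andP[].
Qed.

(** The weights [2 ^ (- u)] over all sizes [u >= 1] sum to at most 1, so the proportion of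
    non-sparse graphs is at most [L / #|S|]. *)
Lemma card_not_sparse :
  #|[set G in regular_graphs d S | ~~ sparse L S G]| * #|S|
    <= L * #|regular_graphs d S|.
Proof.
pose small u := L * u <= #|S|.
have cover : [set G in regular_graphs d S | ~~ sparse L S G] \subset
    \bigcup_(u < #|S| | small u.+1) dense_graphs u.+1.
  apply/subsetP => G; rewrite inE => /andP[regG] /forallPn[U].
  rewrite negb_imply negbK => /andP[/and3P[US U_gt0 U_small] dU].
  have lt : #|U|.-1 < #|S| by rewrite prednK // subset_leq_card.
  apply/bigcupP; exists (Ordinal lt); rewrite /small /= prednK //.
  by rewrite inE regG; apply/existsP; exists U; rewrite US eqxx.
apply: leq_trans (leq_mul (subset_leq_card cover) (leqnn _)) _.
apply: leq_trans (leq_mul (card_bigcup_le _ _) (leqnn _)) _.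
rewrite big_distrl /= big_mkcond /=.
apply: (@sum_geometric_le (fun u => if small u.+1
                                    then #|dense_graphs u.+1| * #|S| else 0)).
move=> u _; case: ifP => // small_u.
exact: card_dense_graphs.
Qed.
End UnionBound.

(** * Contraction of the error set in a sparse graph *)

Definition arcs n (G : graph n) (P Q : {set vtx n}) : graph n :=
  [set e in G | (e.1 \in P) && (e.2 \in Q)].

Lemma card_arcsC n (S : {set vtx n}) d (G : graph n) (P Q : {set vtx n}) :
  regular_on S d G -> #|arcs G P Q| = #|arcs G Q P|.
Proof.
case/regular_onP=> sym _ _ _; rewrite -(card_flip (arcs G Q P)).
by apply: eq_card => -[x y]; rewrite !inE /= sym [(_ \in P) && _]andbC.
Qed.

Lemma card_arcs n (G : graph n) (P Q : {set vtx n}) :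
  #|arcs G P Q| = \sum_(x in P) #|nbrs G x :&: Q|.
Proof.
have -> : arcs G P Q = [set e in [set e in G | e.2 \in Q] | e.1 \in P].
  by apply/setP => e; rewrite !inE -andbA [(_ \in P) && _]andbC.
rewrite card_pairs_in; apply: eq_bigr => x _.
by apply: eq_card => y; rewrite !inE.
Qed.

(** The arcs from [W'] to [W] and those from [W] to [W' :\: W] are disjoint, so the union of [W] and
    [W'] contains at least [3 * #|W'| + 3 * #|W' :\: W|] arcs. Sparsity puts twice this number below
    [5 * (#|W| + #|W' :\: W|)]. *)
Lemma sparse_contraction n (S : {set vtx n}) d L (G : graph n) (W W' : {set vtx n}) :
  regular_on S d G -> sparse L S G -> W \subset S -> W' \subset S ->
  L * d.+1 * #|W| <= #|S| -> (forall x, x \in W' -> 3 <= #|nbrs G x :&: W|) ->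
  6 * #|W'| <= 5 * #|W|.
Proof.
move=> regG spG WS W'S W_small W'_nbrs.
have arcs_ge (P : {set vtx n}) : P \subset W' -> 3 * #|P| <= #|arcs G P W|.
  move=> /subsetP PW'; rewrite card_arcs mulnC -sum_nat_const.
  by apply: leq_sum => x /PW' /W'_nbrs.
(* Counting arcs from [W] bounds the union by [d.+1 * #|W|], small enough for sparsity to apply. *)
have W'_le : #|W'| <= d * #|W|.
  apply: leq_trans (_ : 3 * #|W'| <= _); first by rewrite leq_pmull.
  apply: leq_trans (arcs_ge _ (subxx _)) _.
  rewrite (card_arcsC _ _ regG) card_arcs mulnC -sum_nat_const.
  apply: leq_sum => x _; apply: leq_trans (card_nbrs_le x regG).
  exact/subset_leq_card/subsetIl.
set U := W :|: W'.
have cardU : #|U| = #|W| + #|W' :\: W|.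
  by rewrite -[LHS](cardsID W) /U setUK setDUl setDv set0U.
have U_small : L * #|U| <= #|S|.
  apply: leq_trans W_small; rewrite -mulnA leq_mul2l mulSn cardU leq_add2l.
  by rewrite (leq_trans _ W'_le) ?orbT ?subset_leq_card ?subsetDl.
have [W0|W_gt0] := posnP #|W|; first by rewrite W0 muln0 in W'_le *; lia.
move/forallP/(_ U): spG; rewrite subUset WS W'S U_small cardU addn_gt0 W_gt0 /=.
rewrite /dense cardU -ltnNge.
have : #|arcs G W' W| + #|arcs G W (W' :\: W)| <= #|inner G U|.
  rewrite -cardsUI (_ : _ :&: _ = set0) ?cards0 ?addn0; last first.
    apply/setP => e; rewrite !inE.
    by case: (_ \in W); rewrite ?andbF ?andbT //= ?andbF.
  apply/subset_leq_card/subsetP => e; rewrite !inE.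
  by case/orP => /and3P[->]; [move=> -> -> | move=> -> /andP[_ ->]]; rewrite ?orbT.
rewrite (card_arcsC W (W' :\: W) regG).
have := arcs_ge _ (subxx _); have := arcs_ge _ (subsetDl W' W).
have arith a b i w p q : 3 * q <= b -> 3 * p <= a -> a + b <= i ->
  2 * i < 5 * (w + q) -> 6 * p <= 5 * w by lia.
exact: arith.
Qed.

(** * The Majority step on a graph of the block model *)

Section Majority.
Variables (n d1 d2 : nat) (tie : bool).
Hypothesis d_gap : d2 + 4 < d1.
Implicit Types (A N : {set vtx n}).

Lemma sum_spin A N :
  (\sum_(j in N) spin A j = #|N :&: A|%:Z - #|N :\: A|%:Z)%R.
Proof.
rewrite (bigID (mem A)) /=; congr (_ + _)%R.
  rewrite (eq_bigr (fun=> 1%R)); last by move=> j /andP[_ jA]; rewrite /spin jA.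
  rewrite sumr_const natz; congr Posz.
  by apply: eq_card => j; rewrite !inE.
rewrite (eq_bigr (fun=> (-1)%R)).
  rewrite sumr_const mulNrn natz; congr (- Posz _)%R.
  by apply: eq_card => j; rewrite !inE andbC.
by move=> j /andP[_ jA]; rewrite /spin (negPf jA).
Qed.

Lemma sum_spin_setU A N1 N2 : [disjoint N1 & N2] ->
  (\sum_(j in N1 :|: N2) spin A j =
     #|N1|%:Z - 2%:Z * #|N1 :\: A|%:Z + #|N2|%:Z - 2%:Z * #|N2 :\: A|%:Z)%R.
Proof.
move=> disj; rewrite (eq_bigl [in [predU N1 & N2]]); last by move=> j; rewrite !inE.
rewrite bigU //= !sum_spin.
have arith (p q r s a b : nat) : p + q = a -> r + s = b ->
  (p%:Z - q%:Z + (r%:Z - s%:Z) = a%:Z - 2%:Z * q%:Z + b%:Z - 2%:Z * s%:Z)%R by lia.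
by apply: arith; apply: cardsID.
Qed.

Variables (S : {set vtx n}) (t : graph n * graph n * graph n).
Hypothesis t_sbm : t \in sbm_triples d1 d2 S.

Let regA : regular_on S d1 t.1.1.
Proof. by move: t_sbm; rewrite inE => /andP[/andP[]]. Qed.

Let regB : regular_on (~: S) d1 t.1.2.
Proof. by move: t_sbm; rewrite inE => /andP[/andP[]]. Qed.

Lemma sbm_nbrs x : exists N : {set vtx n},
  let N1 := nbrs (if x \in S then t.1.1 else t.1.2) x in
  [/\ nbrs (sbm_graph t) x = N1 :|: N, [disjoint N1 & N], #|N1| = d1 & #|N| = d2].
Proof.
exists (nbrs t.2 x).
have [symA irrA subA degA] := regular_onP _ _ _ regA.
have [symB irrB subB degB] := regular_onP _ _ _ regB.
have : bip_regular_on S (~: S) d2 t.2 by move: t_sbm; rewrite inE => /andP[].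
case/andP=> /andP[_ /subsetP subH] /forall_inP degH.
have {}degH : #|nbrs t.2 x| = d2 by apply/eqP/degH; rewrite setUCr inE.
have crossH y : (x, y) \in t.2 -> (x \in S) = (y \notin S).
  by move/subH; rewrite !inE /=; do 2 case: (_ \in S).
case: ifP => xS; split=> //=.
- apply/setP => y; rewrite !inE; case: (boolP ((x, y) \in t.1.2)) => [/subB|_].
    by rewrite inE xS.
  by rewrite orbF.
- rewrite -setI_eq0; apply/eqP/setP => y; rewrite !inE symA.
  by apply/negP => /andP[/subA yS /crossH]; rewrite xS yS.
- exact: degA.
- apply/setP => y; rewrite !inE; case: (boolP ((x, y) \in t.1.1)) => [/subA|_] //.
  by rewrite xS.
- rewrite -setI_eq0; apply/eqP/setP => y; rewrite !inE symB.
  by apply/negP => /andP[/subB + /crossH]; rewrite xS inE => /negPf->.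
- by apply: degB; rewrite inE xS.
Qed.

(** A wrong label means a spin sum of at most 0. Even if all [d2] neighbours across are wrong, twice
    the number of wrong neighbours on the own side is at least [d1 - d2 >= 5], under either tie
    convention. *)
Lemma majority_wrong_in A x :
  x \in S :\: majority_step tie (sbm_graph t) A ->
  3 <= #|nbrs t.1.1 x :&: (S :\: A)|.
Proof.
rewrite !inE => /andP[+ xS].
have [N] := sbm_nbrs x; rewrite xS => -[-> disj N1d Nd].
rewrite sum_spin_setU // N1d Nd.
have -> : nbrs t.1.1 x :&: (S :\: A) = nbrs t.1.1 x :\: A.
  apply/setP => y; rewrite !inE; case: (boolP ((x, y) \in t.1.1)); rewrite ?andbF //.
  have [symA _ subA _] := regular_onP _ _ _ regA.
  by rewrite symA => /subA->; rewrite andbT.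
have := subset_leq_card (subsetDl N A); rewrite Nd; lia.
Qed.

Lemma majority_wrong_out A x :
  x \in majority_step tie (sbm_graph t) A :\: S ->
  3 <= #|nbrs t.1.2 x :&: (A :\: S)|.
Proof.
rewrite !inE => /andP[/negPf xS].
have [N] := sbm_nbrs x; rewrite xS => -[-> disj N1d Nd].
rewrite sum_spin_setU // N1d Nd.
have -> : nbrs t.1.2 x :&: (A :\: S) = nbrs t.1.2 x :&: A.
  apply/setP => y; rewrite !inE; case: (boolP ((x, y) \in t.1.2)) => //.
  have [symB _ subB _] := regular_onP _ _ _ regB.
  by rewrite symB => /subB; rewrite inE => ->.
have := cardsID A (nbrs t.1.2 x); rewrite N1d.
by lia.
Qed.

(** The errors in [S] and in its complement contract separately, each governed by the graph on its
    own side. After [r] steps their sizes are below 1, hence 0. *)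
Lemma majority_converges L A r :
  sparse L S t.1.1 -> sparse L (~: S) t.1.2 ->
  L * d1.+1 * #|S :\: A| <= #|S| -> L * d1.+1 * #|A :\: S| <= #|~: S| ->
  5 ^ r * #|S :\: A| < 6 ^ r -> 5 ^ r * #|A :\: S| < 6 ^ r ->
  iter r (majority_step tie (sbm_graph t)) A = S.
Proof.
move=> spA spB inA inB; set step := majority_step _ _.
have stepA B : L * d1.+1 * #|S :\: B| <= #|S| -> 6 * #|S :\: step B| <= 5 * #|S :\: B|.
  move=> small; apply: (sparse_contraction regA spA) => //; try exact: subsetDl.
  by move=> x; apply: majority_wrong_in.
have stepB B : L * d1.+1 * #|B :\: S| <= #|~: S| -> 6 * #|step B :\: S| <= 5 * #|B :\: S|.
  move=> small; apply: (sparse_contraction regB spB) => //;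
    try by rewrite setDE subsetIr.
  by move=> x; apply: majority_wrong_out.
(* The smallness of the error set is carried along, since contraction applies only below the
   sparsity threshold. *)
have decay (f : {set vtx n} -> nat) s : L * d1.+1 * f A <= s ->
    (forall B, L * d1.+1 * f B <= s -> 6 * f (step B) <= 5 * f B) ->
    5 ^ r * f A < 6 ^ r -> f (iter r step A) = 0.
  move=> small contr lt_r.
  have : L * d1.+1 * f (iter r step A) <= s /\ 6 ^ r * f (iter r step A) <= 5 ^ r * f A.
    elim: r {lt_r} => [|k [smallk lek]]; first by rewrite !mul1n.
    have le6 := contr _ smallk; rewrite iterS.
    move: (iter k step A) smallk lek le6 => B smallk lek le6.
    split; last by rewrite !expnS -!mulnA; move: (leq_mul (leqnn (6 ^ k)) le6); lia.
    by apply: leq_trans smallk; rewrite leq_mul2l; apply/orP; right; lia.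
  case=> _ le; case: (posnP (f (iter r step A))) => // f_gt0.
  by have := leq_ltn_trans le lt_r; rewrite -{2}(muln1 (6 ^ r)) ltn_mul2l; lia.
move=> ltA ltB; apply/eqP; rewrite eqEsubset -!setD_eq0 -!cards_eq0.
have /= -> := decay (fun B => #|S :\: B|) _ inA stepA ltA.
by have /= -> := decay (fun B => #|B :\: S|) _ inB stepB ltB.
Qed.
End Majority.

(** * Circulant graphs and nonemptiness of the model *)

Lemma set_of_card (T : finType) k : k <= #|T| -> exists D : {set T}, #|D| = k.
Proof.
move=> kT; have /card_gt0P[D] : 0 < #|[set D : {set T} | D \subset setT & #|D| == k]|.
  by rewrite cards_draws cardsT bin_gt0.
by rewrite inE => /andP[_ /eqP]; exists D.
Qed.

(** The labels in ['I_m.+1] bring in the group of integers modulo [m.+1], in which differences of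
    labels are taken. *)
Lemma set_numbering (T : finType) (S : {set T}) m : #|S| = m.+1 ->
  exists f : T -> 'I_m.+1, {in S &, injective f}.
Proof.
move=> Sm; exists (fun x => inord (index x (enum S))) => x y xS yS.
have lt z : z \in S -> index z (enum S) < m.+1.
  by rewrite -Sm cardE index_mem mem_enum.
move/(congr1 val); rewrite /= !inordK ?lt //.
by move/(congr1 (nth x (enum S))); rewrite !nth_index ?mem_enum.
Qed.

Lemma card_numbering (T : finType) (S : {set T}) m (f : T -> 'I_m.+1) (D : {set 'I_m.+1}) :
  #|S| = m.+1 -> {in S &, injective f} -> #|[set x in S | f x \in D]| = #|D|.
Proof.
move=> Sm f_inj.
have fS : f @: S = setT.
  by apply/eqP; rewrite eqEcard subsetT (card_in_imset f_inj) Sm cardsT card_ord leqnn.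
have f_inj' : {in [set x in S | f x \in D] &, injective f}.
  move=> x y; rewrite !inE => /andP[xS _] /andP[yS _].
  exact: f_inj.
rewrite -(card_in_imset f_inj').
apply: eq_card => i; apply/imsetP/idP => [[x + ->]|iD]; first by rewrite inE => /andP[].
have : i \in f @: S by rewrite fS inE.
by case/imsetP=> x xS ix; exists x; rewrite // inE xS -ix.
Qed.

(** The connection set of a circulant graph: [1, ..., h] and their opposites with [h = d./2], and
    for odd [d] also the element [m.+1 / 2], which is its own opposite and exists because [m.+1] is
    then even. *)
Lemma symmetric_ord_set m d : d <= m -> ~~ odd (m.+1 * d) ->
  exists D : {set 'I_m.+1},
    [/\ 0%R \notin D, forall i, (- i \in D)%R = (i \in D) & #|D| = d].
Proof.
move=> dm even_md; set h := d./2.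
have d_eq : d = odd d + h.*2 by rewrite odd_double_half.
have oppE (i : 'I_m.+1) : 0 < i -> (- i)%R = m.+1 - i :> nat.
  by move=> i_gt0; rewrite /= modn_small // ltn_subrL i_gt0.
pose D1 : {set 'I_m.+1} := [set i : 'I_m.+1 | 0 < i <= h].
pose D2 : {set 'I_m.+1} := [set - i | i in D1]%R.
pose D3 : {set 'I_m.+1} := [set i : 'I_m.+1 | odd d && (i.*2 == m.+1)].
have D1_card : #|D1| = h.
  pose f (i : 'I_h) : 'I_m.+1 := inord i.+1.
  have fE (i : 'I_h) : f i = i.+1 :> nat by rewrite inordK //; have := ltn_ord i; lia.
  have f_inj : injective f.
    by move=> i k /(congr1 val); rewrite /= !fE => -[] /val_inj.
  rewrite -[RHS]card_ord -cardsT -(card_imset _ f_inj).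
  apply: eq_card => i; apply/idP/imsetP => [|[k _ ->]].
    rewrite inE => /andP[i_gt0 ih]; have lt : i.-1 < h by lia.
    by exists (Ordinal lt); rewrite ?inE //=; apply: val_inj; rewrite /= fE /=; lia.
  by rewrite inE fE; have := ltn_ord k; lia.
have D2_card : #|D2| = h by rewrite card_imset ?D1_card //; apply: oppr_inj.
have D3_card : #|D3| = odd d.
  case: (boolP (odd d)) => d_odd; last first.
    by apply: eq_card0 => i; rewrite !inE (negPf d_odd).
  move: even_md; rewrite oddM d_odd andbT => even_m.
  rewrite -[RHS](cards1 (inord (m.+1)./2 : 'I_m.+1)); apply: eq_card => i; rewrite !inE d_odd /=.
  by apply/eqP/eqP => [im|->]; [apply: val_inj; rewrite /= inordK | rewrite inordK]; lia.
have D2E i : (i \in D2) = (0 < i) && (m.+1 - h <= i).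
  apply/imsetP/andP => [[k + ->]|[i_gt0 im]].
    by rewrite inE => /andP[k_gt0 kh]; rewrite oppE //; have := ltn_ord k; lia.
  exists (- i)%R; last by rewrite opprK.
  by rewrite inE oppE //; have := ltn_ord i; lia.
exists (D1 :|: D2 :|: D3); split.
- by rewrite !inE D2E /=; lia.
- move=> i; have [->|i_neq0] := eqVneq i 0%R; first by rewrite oppr0.
  have i_gt0 : 0 < i by rewrite lt0n; apply: contraNneq i_neq0 => i0; apply/eqP/val_inj.
  by rewrite !inE !D2E !oppE //; have := ltn_ord i; case: (odd d); lia.
- rewrite -[d in RHS](odd_double_half d) -/h -addnn addnC -{1}D1_card -D2_card -D3_card.
  have d12 : D1 :&: D2 = set0.
    by apply/setP => i; rewrite 2!inE D2E inE; have := ltn_ord i; lia.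
  have d123 : (D1 :|: D2) :&: D3 = set0.
    apply/setP => i; rewrite 3!inE D2E !inE; have := ltn_ord i.
    by case: (odd d) (odd_double_half d); rewrite -/h; lia.
  by rewrite -cardsUI d12 cards0 addn0 -cardsUI d123 cards0 addn0.
Qed.

(** Vertices are joined when their labels differ by an element of [D]; [D = - D] gives symmetry and
    the absence of 0 excludes loops. *)
Lemma regular_graph_exists n (S : {set vtx n}) d :
  d < #|S| -> ~~ odd (#|S| * d) -> exists G : graph n, regular_on S d G.
Proof.
case E : #|S| => [//|m] dm even_md.
have [f f_inj] := set_numbering E.
have [D [D0 DN Dd]] := @symmetric_ord_set m d dm even_md.
exists [set e : vtx n * vtx n | [&& e.1 \in S, e.2 \in S & f e.2 - f e.1 \in D]%R].
apply/regular_onP; split.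
- by move=> x y; rewrite !inE /= -DN opprB andbCA.
- by move=> x; rewrite inE /= subrr (negPf D0) !andbF.
- by move=> x y; rewrite inE => /andP[].
- move=> x xS; rewrite -Dd -(card_numbering (f := fun y => f y - f x)%R D E).
    by apply: eq_card => y; rewrite !inE xS.
  by move=> y z yS zS /addIr; apply: f_inj.
Qed.

(** The bipartite analogue: labels are compared across the two sides, so any [D] of size [d]
    serves. *)
Lemma bip_regular_exists n (S T : {set vtx n}) d :
  [disjoint S & T] -> #|S| = #|T| -> 0 < #|S| -> d <= #|S| ->
  exists H : graph n, bip_regular_on S T d H.
Proof.
move=> disj; case ES : #|S| => [//|m] /esym ET _ dm.
have [f f_inj] := set_numbering ES; have [g g_inj] := set_numbering ET.
have [D Dd] : exists D : {set 'I_m.+1}, #|D| = d by apply: set_of_card; rewrite card_ord.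
have ST x : x \in S -> x \in T = false by move/(disjointFr disj).
have TS x : x \in T -> x \in S = false by move/(disjointFl disj).
pose R x y := [&& x \in S, y \in T & g y - f x \in D]%R.
exists [set e : vtx n * vtx n | R e.1 e.2 || R e.2 e.1].
apply/andP; split; first (apply/andP; split).
- apply/simple_graphP; split=> [x y|x]; rewrite !inE /=; first exact: orbC.
  by rewrite orbb; apply/negP => /and3P[/ST->].
- by apply/subsetP => e; rewrite !inE => /orP[] /and3P[-> ->]; rewrite ?orbT.
apply/forall_inP => x; rewrite inE -Dd => /orP[xS|xT]; apply/eqP.
- rewrite -(card_numbering (f := fun y => g y - f x)%R D ET).
    by apply: eq_card => y; rewrite !inE /R /= xS (ST _ xS) andbF orbF.
  by move=> y z yT zT /addIr; apply: g_inj.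
- rewrite -(card_numbering (f := fun y => g x - f y)%R D ES).
    by apply: eq_card => y; rewrite !inE /R /= xT (TS _ xT).
  by move=> y z yS zS /addrI/oppr_inj; apply: f_inj.
Qed.

(** * Probability bounds and recovery *)

(** The constant [L] depends on [d] alone, which lets epsilon be fixed before [n]. *)
Lemma sparse_whp d : 0 < d -> exists2 L, 0 < L &
  forall n (S : {set vtx n}), 8 * d.+1 <= #|S| ->
    #|[set G in regular_graphs d S | ~~ sparse L S G]| * #|S|
      <= L * #|regular_graphs d S|.
Proof.
move=> d_gt0; exists (256 * (4 ^ 9 * (2 * d) ^ 5)) => [|n S S_large].
  by rewrite muln_gt0 (muln_gt0 (4 ^ 9)) !expn_gt0 muln_gt0 d_gt0.
exact: card_not_sparse.
Qed.

(** The triples form a product set, so the bad ones are covered by two products with one non-sparse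
    factor, each of proportion at most [L / n]. *)
Lemma card_bad_triples n d1 d2 L (S : {set vtx n}) :
  (forall T : {set vtx n}, #|T| = n ->
     #|[set G in regular_graphs d1 T | ~~ sparse L T G]| * n
       <= L * #|regular_graphs d1 T|) ->
  #|S| = n ->
  #|[set t in sbm_triples d1 d2 S | ~~ (sparse L S t.1.1 && sparse L (~: S) t.1.2)]| * n
    <= 2 * L * #|sbm_triples d1 d2 S|.
Proof.
move=> bad_le Sn; pose R (T : {set vtx n}) := regular_graphs d1 T.
have Cn : #|~: S| = n by have := cardsC S; rewrite card_ord Sn; lia.
pose B (T : {set vtx n}) : {set graph n} := [set G in R T | ~~ sparse L T G].
pose H : {set graph n} := [set H | bip_regular_on S (~: S) d2 H].
have -> : sbm_triples d1 d2 S = setX (setX (R S) (R (~: S))) H.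
  by apply/setP => t; rewrite !inE.
set bad := [set t in _ | _].
have cover : bad \subset setX (setX (B S) (R (~: S))) H :|: setX (setX (R S) (B (~: S))) H.
  apply/subsetP => t; rewrite !inE negb_and.
  by case/andP => /andP[/andP[-> ->] ->] /orP[] ->; rewrite ?orbT.
have le_bad := leq_trans (subset_leq_card cover) (leq_card_setU _ _).
apply: leq_trans (leq_mul le_bad (leqnn n)) _; rewrite !cardsX.
have := bad_le _ Sn; have := bad_le _ Cn.
rewrite -/(R S) -/(R (~: S)) -/(B S) -/(B (~: S)).
move: #|B S| #|B (~: S)| #|R S| #|R (~: S)| #|H| => b b' r r' h lb' lb.
have := leq_mul lb (leqnn (r' * h)); have := leq_mul lb' (leqnn (r * h)); lia.
Qed.

Lemma sbm_triples_gt0 n d1 d2 (S : {set vtx n}) :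
  0 < n -> #|S| = n -> d1 < n -> d2 <= n -> ~~ odd (n * d1) ->
  0 < #|sbm_triples d1 d2 S|.
Proof.
move=> n_gt0 Sn d1n d2n even_nd; have Cn : #|~: S| = n.
  by have := cardsC S; rewrite card_ord Sn; lia.
have [GA regA] : exists G : graph n, regular_on S d1 G.
  by apply: regular_graph_exists; rewrite Sn.
have [GB regB] : exists G : graph n, regular_on (~: S) d1 G.
  by apply: regular_graph_exists; rewrite Cn.
have [H bipH] : exists H : graph n, bip_regular_on S (~: S) d2 H.
  by apply: bip_regular_exists; rewrite ?Sn ?Cn // -subsets_disjoint.
by apply/card_gt0P; exists (GA, GB, H); rewrite inE regA regB.
Qed.

(** Averaging over the true partition: a bound valid given each equipartition passes to the mean. *)
Lemma sbm_prob_ge n d1 d2 (E : {set vtx n} -> graph n -> bool) (p : rat) :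
  (forall S : {set vtx n}, #|S| = n -> (p * #|sbm_triples d1 d2 S|%:R <=
     #|[set t in sbm_triples d1 d2 S | E S (sbm_graph t)]|%:R)%R) ->
  (forall S : {set vtx n}, #|S| = n -> 0 < #|sbm_triples d1 d2 S|) ->
  (p <= sbm_prob d1 d2 E)%R.
Proof.
move=> le_p pos; rewrite /sbm_prob; set k := #|_|.
have k_gt0 : 0 < k.
  have -> : k = 'C(n.*2, n).
    rewrite -(card_ord n.*2) -cardsT -cards_draws.
    by apply: eq_card => A; rewrite !inE subsetT.
  by rewrite bin_gt0 -addnn leq_addr.
rewrite mulrC ler_pdivlMr ?ltr0n //.
have -> : (p * k%:R = \sum_(A : {set vtx n} | #|A| == n) p)%R.
  by rewrite sumr_const mulr_natr; congr (_ *+ _)%R; apply: eq_card => A; rewrite inE.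
apply: ler_sum => S /eqP Sn; rewrite ler_pdivlMr ?ltr0n ?pos //.
exact: le_p.
Qed.

Lemma majority_time n w : 1 < n -> w < n ->
  5 ^ (8 * trunc_log 2 n) * w < 6 ^ (8 * trunc_log 2 n).
Proof.
move=> n_gt1 wn; set l := trunc_log 2 n.
have l_gt0 : 0 < l by rewrite trunc_log_gt0.
(* [n < 2 ^ l.+1], and [l.+1 <= 2 * l] as [l] is positive; thus [2 * l] halvings suffice. *)
have n_lt : n < 2 ^ (2 * l).
  apply: leq_trans (trunc_log_ltn n (isT : 1 < 2)) _.
  by rewrite leq_exp2l // -/l; lia.
have six : 2 ^ (2 * l) * 5 ^ (8 * l) <= 6 ^ (8 * l).
  (* [2 * 5 ^ 4 <= 6 ^ 4], so four contractions by [5/6] halve the error set. *)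
  rewrite (_ : 8 * l = 4 * (2 * l)); last by rewrite mulnA.
  rewrite !(expnM _ 4) -expnMn.
  exact: leq_exp2rW.
apply: leq_trans six; rewrite mulnC ltn_mul2r expn_gt0 /=.
exact: ltn_trans wn n_lt.
Qed.

Lemma sparse_recovery n d1 d2 tie L (S : {set vtx n}) t :
  d2 + 4 < d1 -> 0 < L -> 1 < n -> #|S| = n -> t \in sbm_triples d1 d2 S ->
  sparse L S t.1.1 -> sparse L (~: S) t.1.2 ->
  forall A : {set vtx n},
    ((1 - (L * d1.+1)%:R^-1 : rat) * n%:R < #|A :&: S|%:R)%R ->
    ((1 - (L * d1.+1)%:R^-1 : rat) * n%:R < #|~: A :&: ~: S|%:R)%R ->
    iter (8 * trunc_log 2 n) (majority_step tie (sbm_graph t)) A = S.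
Proof.
move=> gap L_gt0 n_gt1 Sn t_sbm spA spB A inA inB.
have Cn : #|~: S| = n by have := cardsC S; rewrite card_ord Sn; lia.
set K := L * d1.+1 in inA inB *; have K_gt0 : 0 < K by rewrite muln_gt0 L_gt0.
(* With epsilon equal to [1 / K], the overlap hypothesis says exactly that the error count [w]
   satisfies [K * w < n]. *)
have small (a w : nat) : a + w = n -> ((1 - K%:R^-1 : rat) * n%:R < a%:R)%R -> K * w < n.
  move=> <-; rewrite mulrBl mul1r ltrBlDr natrD ltrD2l => lt_w.
  by move: lt_w; rewrite mulrC ltr_pdivlMr ?ltr0n // -natrD -natrM ltr_nat mulnC.
have wA : K * #|S :\: A| < n.
  by apply: small inA; rewrite setIC cardsID.
have wB : K * #|A :\: S| < n.
  apply: small inB; rewrite -[RHS]Cn -(cardsID (~: A) (~: S)) setIC; congr (_ + _).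
  by apply: eq_card => x; rewrite !inE negbK andbC.
have lt w : K * w < n -> w < n.
  by apply: leq_ltn_trans; rewrite leq_pmull.
apply: (majority_converges tie gap t_sbm spA spB); rewrite ?Sn ?Cn -/K; try exact: ltnW.
all: by apply: majority_time => //; apply: lt.
Qed.

Theorem theorem1p7 :
  forall d1 : nat, (3 <= d1)%N ->
  exists eps : rat, (0 < eps)%R /\
  exists C : nat,
  forall d2 : nat, (3 <= d2)%N -> (d2 + 4 < d1)%N ->
  forall tie : bool,
  forall delta : rat, (0 < delta)%R ->
  exists N : nat, forall n : nat, (N <= n)%N -> ~~ odd (n * d1) ->
    (1 - delta <= sbm_prob d1 d2
       (fun (Atrue : {set 'I_(n.*2)}) (G : {set 'I_(n.*2) * 'I_(n.*2)}) =>
          [forall A : {set 'I_(n.*2)},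
             (((1 - eps) * n%:R < #|A :&: Atrue|%:R)%R &&
              ((1 - eps) * n%:R < #|~: A :&: ~: Atrue|%:R)%R)
             ==>
             [exists t : 'I_(C * trunc_log 2 n).+1,
                iter t (majority_step tie G) A == Atrue]]))%R.
Proof.
move=> d1 d1_ge3; have d1_gt0 : 0 < d1 by apply: leq_trans d1_ge3.
have [L L_gt0 whp] := sparse_whp d1_gt0.
exists ((L * d1.+1)%:R^-1)%R; split; first by rewrite invr_gt0 ltr0n muln_gt0 L_gt0.
exists 8 => d2 _ gap tie delta delta_gt0.
pose q : rat := ((2 * L)%:R / delta)%R.
(* The first bound on [n] serves the switching argument, the second makes the bad proportion
   [2 * L / n] at most [delta]. *)
exists (maxn (8 * d1.+1) (Num.bound q)) => n.
rewrite geq_max => /andP[n_large n_bound] even_nd.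
have n_gt0 : 0 < n by lia.
have n_gt1 : 1 < n by lia.
have delta_n : ((2 * L)%:R <= delta * n%:R)%R.
  rewrite mulrC -ler_pdivrMr //; apply/ltW/(lt_le_trans (archi_boundP _)).
    by rewrite divr_ge0 ?ler0n ?ltW.
  by rewrite ler_nat.
apply: sbm_prob_ge => S Sn; last by apply: sbm_triples_gt0 => //; lia.
set good := finset _.
set triples := sbm_triples d1 d2 S.
pose bad := [set t in triples | ~~ (sparse L S t.1.1 && sparse L (~: S) t.1.2)].
have bad_le : #|bad| * n <= 2 * L * #|triples|.
  apply: card_bad_triples => // T Tn.
  by have := whp n T; rewrite Tn; apply.
have good_ge : #|triples| <= #|good| + #|bad|.
  apply: leq_trans (leq_card_setU _ _); apply/subset_leq_card/subsetP => t t_sbm.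
  rewrite in_setU [t \in bad]inE [t \in good]inE t_sbm /=.
  case: (boolP (_ && _)) => [/andP[spA spB]|_]; last by rewrite orbT.
  rewrite orbF; apply/forallP => A; apply/implyP => /andP[inA inB].
  (* The last admissible time, [8 * trunc_log 2 n], works for every [A]. *)
  apply/existsP; exists ord_max; apply/eqP.
  exact: (sparse_recovery (d2 := d2) tie gap L_gt0).
rewrite mulrBl mul1r lerBlDr.
apply: (@le_trans _ _ (#|good| + #|bad|)%:R%R).
  by rewrite ler_nat.
rewrite natrD lerD2l -(@ler_pM2r _ n%:R%R) ?ltr0n //.
rewrite -natrM mulrAC; apply: le_trans (ler_wpM2r _ delta_n); last exact: ler0n.
by rewrite -natrM ler_nat.
Qed.
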